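(* Let $(\Omega,\mathcal F,P)$ be $[0,1]$ with its Borel sigma-algebra and the uniform probability measure, $p\in[1,\infty)$, $\mathcal Z=L_p(\Omega,\mathcal F,P)$, let $\mathcal G\subset\mathcal F$ be a sub-sigma-algebra and $\hat{\mathcal Z}=L_p(\Omega,\mathcal G,P)$, with dual $\hat{\mathcal Z}^*=L_q(\Omega,\mathcal G,P)$, $1/p+1/q=1$. Let $\mathfrak G$ be the set of all measure-preserving transformations $T:\Omega\to\Omega$ such that $T(A)\in\mathcal G$ for all $A\in\mathcal G$. Suppose that for every $\eta\in\hat{\mathcal Z}^*$ with $\eta\ge0$ there exist a monotonically nondecreasing right-continuous function $\zeta:[0,1)\to\mathbb R$ and $T\in\mathfrak G$ such that $\eta=\zeta\circ T$ a.e. Then every law invariant coherent risk measure $\varrho:\hat{\mathcal Z}\to\mathbb R$ is regular, i.e., there exists a law invariant coherent risk measure $\rho:\mathcal Z\to\mathbb R$ such that $\rho|_{\hat{\mathcal Z}}=\varrho$.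
   Context: A measure-preserving transformation is a map $T:\Omega\to\Omega$ that is one-to-one, onto, and satisfies $P(A)=P(T(A))$ for all $A\in\mathcal F$. A coherent risk measure on a space $\mathcal X$ of random variables is a functional $\rho:\mathcal X\to\mathbb R$ that is monotone ($Z\ge Z'$ a.e. implies $\rho(Z)\ge\rho(Z')$), convex, translation equivariant ($\rho(Z+a)=\rho(Z)+a$ for $a\in\mathbb R$) and positively homogeneous ($\rho(tZ)=t\rho(Z)$ for $t\ge0$). It is law invariant if $\rho(Z_1)=\rho(Z_2)$ whenever $Z_1,Z_2\in\mathcal X$ have the same cumulative distribution function. *)

(* Defs.v *)
From HB Require Import structures.
From mathcomp Require Import all_boot all_order all_algebra.
From mathcomp Require Import all_classical all_reals all_analysis.
Set Implicit Arguments.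
Unset Strict Implicit.
Unset Printing Implicit Defensive.
Import Order.TTheory GRing.Theory Num.Theory.
Import numFieldNormedType.Exports.

Local Open Scope classical_set_scope.
Local Open Scope ring_scope.

Section RiskMeasures.
Context d (T : measurableType d) (R : realType) (P : probability T R).

(* Elements of an L_p space are represented by functions. A functional on a set
   X of functions that is monotone for the a.e. order takes equal values at
   a.e. equal elements of X, hence is a functional on the classes modulo a.e.
   equality. Values outside X are irrelevant. *)
Record coherent_risk_measure (X : set (T -> R)) (rho : (T -> R) -> R) : Prop :=
  CoherentRiskMeasure {
  crm_monotone : forall Z Z', X Z -> X Z' ->
    {ae P, forall w, Z' w <= Z w} -> rho Z' <= rho Z ;
  crm_convex : forall Z Z' (t : R), X Z -> X Z' -> 0 <= t <= 1 ->
    rho (fun w => t * Z w + (1 - t) * Z' w) <= t * rho Z + (1 - t) * rho Z' ;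
  crm_translation : forall Z (a : R), X Z ->
    rho (fun w => Z w + a) = rho Z + a ;
  crm_homogeneous : forall Z (t : R), X Z -> 0 <= t ->
    rho (fun w => t * Z w) = t * rho Z }.

Definition law_invariant (X : set (T -> R)) (rho : (T -> R) -> R) : Prop :=
  forall Z1 Z2 : {RV P >-> R}, X Z1 -> X Z2 ->
    cdf Z1 = cdf Z2 -> rho Z1 = rho Z2.

Definition Lp_space (p : \bar R) : set (T -> R) := [set Z | Z \in Lfun P p].

(* L_p(T, G, P) for a sub-sigma-algebra G of measurable sets. *)
Definition sub_Lp_space (G : set (set T)) (p : \bar R) : set (T -> R) :=
  [set Z | Lp_space p Z /\
           forall B : set R, measurable B -> G (Z @^-1` B)].

Definition regular_risk_measure (G : set (set T)) (p : \bar R)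
    (vrho : (T -> R) -> R) : Prop :=
  exists rho : (T -> R) -> R,
    [/\ coherent_risk_measure (Lp_space p) rho,
        law_invariant (Lp_space p) rho &
        forall Z, sub_Lp_space G p Z -> rho Z = vrho Z].

(* The equality P (S @` A) = P A presupposes that S @` A is an event. *)
Definition measure_preserving_transformation (S : T -> T) : Prop :=
  set_bij [set: T] [set: T] S /\
  forall A, measurable A -> measurable (S @` A) /\ P (S @` A) = P A.

Definition preserving_transformations (G : set (set T)) : set (T -> T) :=
  [set S | measure_preserving_transformation S /\
           forall A, G A -> G (S @` A)].

End RiskMeasures.

Section UnitInterval.
Context (R : realType).

Definition itv01 : Type := {x : R | x \in `[0, 1]}.

HB.instance Definition _ := Choice.copy itv01 {x : R | x \in `[0, 1]}.

Lemma zero_in_itv01 : (0 : R) \in `[0, 1].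
Proof. by rewrite in_itv/= lexx ler01. Qed.

HB.instance Definition _ :=
  isPointed.Build itv01 (exist _ (0 : R) zero_in_itv01).

Definition itv01_val (x : itv01) : R := sval x.

(* The events are the traces on [0, 1] of the Borel subsets of R. *)
Definition Omega := g_sigma_algebra_preimageType itv01_val.

Definition Omega_val (x : Omega) : R := itv01_val x.

Lemma Omega_val_inj : injective Omega_val.
Proof. exact: val_inj. Qed.

Lemma measurable_image_Omega_val (A : set Omega) :
  measurable A -> measurable (Omega_val @` A).
Proof.
case=> B mB; rewrite setTI => <-.
rewrite (_ : _ @` _ = `[0, 1]%classic `&` B); first exact: measurableI.
apply/seteqP; split => [_ [[x x01] Bx <-] //|x [x01 Bx]].
by exists (exist _ x x01).
Qed.

Definition uniform01 (A : set Omega) : \bar R :=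
  lebesgue_measure (Omega_val @` A).

Let uniform01_0 : uniform01 set0 = 0%E.
Proof. by rewrite /uniform01 image_set0 measure0. Qed.

Let uniform01_ge0 A : (0 <= uniform01 A)%E.
Proof. exact: measure_ge0. Qed.

Let uniform01_sigma_additive : semi_sigma_additive uniform01.
Proof.
move=> F mF tF mUF; rewrite /uniform01 image_bigcup.
apply: measure_semi_sigma_additive.
- by move=> i; exact: measurable_image_Omega_val.
- apply/trivIsetP => i j _ _ ij; apply/seteqP; split => // _ [[x Fx <-]].
  move=> [y Fy /Omega_val_inj yx]; rewrite yx in Fy.
  move/trivIsetP : tF => /(_ i j I I ij)/seteqP[+ _].
  by move=> /(_ x); apply.
- by rewrite -image_bigcup; exact: measurable_image_Omega_val.
Qed.

HB.instance Definition _ := isMeasure.Build _ Omega R uniform01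
  uniform01_0 uniform01_ge0 uniform01_sigma_additive.

Let uniform01_setT : uniform01 setT = 1%E.
Proof.
rewrite /uniform01 (_ : _ @` _ = `[0, 1]%classic).
  by rewrite lebesgue_measure_itv/= lte_fin ltr01 oppr0 adde0.
apply/seteqP; split => [_ [[x x01] _ <-] //|x x01].
by exists (exist _ x x01).
Qed.

HB.instance Definition _ :=
  @Measure_isProbability.Build _ Omega R uniform01 uniform01_setT.

End UnitInterval.

Arguments Omega_val {R} x.
Arguments uniform01 R A : clear implicits.

(* Main.v *)
Require Import Defs.
From HB Require Import structures.
From mathcomp Require Import all_boot all_order all_algebra all_fingroup.
From mathcomp Require Import all_classical all_reals all_analysis.
From mathcomp Require Import measurable_realfun ess_sup_inf ring lra.
Import Order.TTheory GRing.Theory Num.Theory.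
Import numFieldNormedType.Exports.
Set Implicit Arguments.
Unset Strict Implicit.
Unset Printing Implicit Defensive.
Local Open Scope classical_set_scope.
Local Open Scope ring_scope.

(* Applied to the indicator of the complement of a set A of G, the hypothesis
   yields a set T(A) of G that is a.e. equal to [0, P(A)). Hence the levels s
   for which [0, s) is a.e. equal to a set of G are exactly the values P(A), and
   they form the trace on [0, 1] of a subgroup of R that contains 1.

   If this subgroup is dense, every [0, c) is a.e. equal to a set of G, so the
   identity is a.e. equal to a map U for which the preimage of every event is in
   G, and rho(Z) := vrho(Z o U) works.

   Otherwise the levels are k/n for 0 <= k <= n, and up to null sets G is
   generated by a partition of [0, 1] into n cells of probability 1/n. On the
   vectors of R^n, vrho is then a symmetric monotone convex function f, and
   rho(Z) := f(x(Z)) works, where x_i(Z) is the mean of the quantile function of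
   Z over the i-th interval of length 1/n from the top. The partial sums of x(Z)
   are convex in Z by the Rockafellar-Uryasev formula, so convexity of rho
   reduces to the fact that f is monotone with respect to majorization. *)

(* If y exceeds x at i0 and is exceeded by x at a later j, moving the smaller of
   the two gaps from i0 to j makes y a convex combination of itself and of y with
   i0 and j exchanged, and increases the number of indices where x and y agree. *)
Lemma majorization_le (R : realFieldType) (n : nat) (f : ('I_n -> R) -> R) :
  (forall x y, (forall i, x i <= y i) -> f x <= f y) ->
  (forall x (s : {perm 'I_n}), f (fun i => x (s i)) = f x) ->
  (forall x y t, 0 <= t <= 1 ->
    f (fun i => t * x i + (1 - t) * y i) <= t * f x + (1 - t) * f y) ->
  forall x y : 'I_n -> R, {homo x : i j / (i <= j)%N >-> j <= i} ->
  (forall k, \sum_(i < n | (i < k)%N) x i <= \sum_(i < n | (i < k)%N) y i) ->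
  f x <= f y.
Proof.
move=> fmono fsym fcvx x y xnincr; move: {2}(#|_|) (leqnn #|[pred i | x i != y i]|).
move=> m; elim: m y => [|m IH] y.
  rewrite leqn0 => /eqP/card0_eq xy _; apply: fmono => i.
  by have := xy i; rewrite !inE => /negbFE/eqP ->.
move=> cxy XY.
have [xy|/existsNP[j0 /negP]] := pselect (forall i, x i <= y i); first exact: fmono.
rewrite -ltNge => xyj0.
have [j xyj jmin] := @arg_minnP _ j0 (fun j => y j < x j) (fun j => nat_of_ord j) xyj0.
have lej (i : 'I_n) : (i < j)%N -> x i <= y i.
  by move=> ij; rewrite leNgt; apply/negP => /jmin; rewrite leqNgt ij.
(* Otherwise [y <= x] before [j] and [y j < x j], against the partial sums through [j]. *)
have [i0 /andP[i0j xyi0]] : exists i : 'I_n, (i < j)%N && (x i < y i).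
  apply/existsP; apply/contraT => /existsPn H.
  have := XY j.+1; rewrite leNgt => /negP[].
  rewrite (bigD1 j)//= [ltRHS](bigD1 j)//=; apply: ltr_leD => //.
  apply: ler_sum => i /andP[]; rewrite ltnS leq_eqVlt.
  move=> /orP[/eqP/val_inj ->|ij _]; first by rewrite eqxx.
  by have := H i; rewrite ij/= -leNgt.
have ji0 : j != i0 by apply: contraTneq i0j => ->; rewrite ltnn.
have yij : 0 < y i0 - y j.
  rewrite subr_gt0 (lt_trans xyj)// (le_lt_trans _ xyi0)//.
  by apply: xnincr; exact: ltnW.
pose d := Num.min (y i0 - x i0) (x j - y j).
have d0 : 0 < d by rewrite lt_min !subr_gt0 xyi0.
have xji : x j <= x i0 by apply: xnincr; exact: ltnW.
have [dl dr] : d <= y i0 - x i0 /\ d <= x j - y j by rewrite !ge_min !lexx orbT.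
(* The weight for which mixing [y] with its exchange moves exactly [d] from [i0] to [j]. *)
pose l := d / (y i0 - y j).
have l01 : 0 <= l <= 1.
  rewrite /l divr_ge0 ?(ltW d0) ?(ltW yij)//= ler_pdivrMr// mul1r.
  by apply: (le_trans dl); lra.
pose s := tperm i0 j.
pose y' i := l * y (s i) + (1 - l) * y i.
have y'i0 : y' i0 = y i0 - d.
  by rewrite /y' /s tpermL /l; field; rewrite gt_eqF.
have y'j : y' j = y j + d.
  by rewrite /y' /s tpermR /l; field; rewrite gt_eqF.
have y'E i : i != i0 -> i != j -> y' i = y i.
  by move=> ii0 ij; rewrite /y' /s tpermD 1?eq_sym//; ring.
have fy' : f y' <= f y.
  apply: (le_trans (fcvx (y \o s) y l l01)).
  by rewrite /= (fsym y s); lra.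
apply: le_trans fy'; apply: IH => [|k].
  have [i xyi xy'i] : exists2 i : 'I_n, x i != y i & x i = y' i.
    have [dE|dE] := leP (y i0 - x i0) (x j - y j).
      by exists i0; rewrite ?lt_eqF// y'i0 /d (min_idPl dE); ring.
    by exists j; rewrite ?gt_eqF// y'j /d (min_idPr (ltW dE)); ring.
  rewrite -ltnS; apply: leq_trans cxy; apply: proper_card; apply/properP; split.
    apply/fintype.subsetP => k; rewrite !inE; apply: contraNneq => xyk.
    rewrite y'E ?xyk//; [apply: contraTneq xyi0|apply: contraTneq xyj] => <-.
      by rewrite xyk ltxx.
    by rewrite xyk ltxx.
  by exists i => //; rewrite unfold_in /= negbK; apply/eqP.
(* Before [j], [x <= y'] holds termwise; past [j], the exchange permutes the indices below [k], so
   [y'] has the partial sum of [y]. *)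
have [kj|jk] := leqP k j.
  apply: ler_sum => i ik.
  have [->|ii0] := eqVneq i i0; first by rewrite y'i0; lra.
  by rewrite y'E ?lej ?(leq_trans ik)//; apply: contraTneq ik => ->; rewrite -leqNgt.
rewrite (le_trans (XY k))// /y' big_split/= -!mulr_sumr.
have -> : \sum_(i < n | (i < k)%N) y (s i) = \sum_(i < n | (i < k)%N) y i.
  rewrite [RHS](reindex_inj (h := s) perm_inj)/=.
  apply: eq_bigl => i; rewrite /s; case: tpermP => // ->.
    by rewrite jk (ltn_trans i0j).
  by rewrite jk (ltn_trans i0j).
by lra.
Qed.

(** * Upper tails and their integrals *)

Section TopIntegral.
Context d (T : measurableType d) (R : realType) (P : probability T R).
Implicit Types (Z W : T -> R) (a b s t : R).

Local Notation integrable Z := (P.-integrable [set: T] (EFin \o Z)).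

Definition excess_mean Z s : R := \int[P]_w Num.max (Z w - s) 0.

(* The Rockafellar-Uryasev formula for the integral of Z over an event of
   probability a that carries its largest values. At a = 0 the infimum is also
   0, but only as a limit for s tending to infinity. *)
Definition top_integral a Z : R :=
  if a == 0 then 0 else inf (range (fun s => a * s + excess_mean Z s)).

Lemma integrable_EFinD Z W : integrable Z -> integrable W ->
  integrable (fun w => Z w + W w).
Proof. by move=> iZ iW; exact: (integrableD measurableT iZ iW). Qed.

Lemma integrable_EFinZ t Z : integrable Z -> integrable (fun w => t * Z w).
Proof. by move=> iZ; exact: (integrableZl measurableT t iZ). Qed.

Lemma integrable_EFin_cst t : integrable (fun=> t).
Proof. exact: finite_measure_integrable_cst. Qed.

Lemma integrable_excess Z s : integrable Z ->
  integrable (fun w => Num.max (Z w - s) 0).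
Proof.
move=> iZ; have := integrable_funrpos measurableT
  (integrable_EFinD iZ (integrable_EFin_cst (- s))).
by apply.
Qed.

Lemma excess_mean_ge0 Z s : 0 <= excess_mean Z s.
Proof. by apply: Rintegral_ge0 => w _; rewrite le_max lexx orbT. Qed.

Lemma le_excess_mean_ae Z W s : integrable Z -> integrable W ->
  {ae P, forall w, Z w <= W w} -> excess_mean Z s <= excess_mean W s.
Proof.
move=> iZ iW ZW; rewrite /excess_mean /Rintegral fine_le//.
- exact: integrable_fin_num (integrable_excess s iZ).
- exact: integrable_fin_num (integrable_excess s iW).
apply: ae_ge0_le_integral => //.
- by move=> w _; rewrite lee_fin le_max lexx orbT.
- exact: measurable_int (integrable_excess s iZ).
- by move=> w _; rewrite lee_fin le_max lexx orbT.
- exact: measurable_int (integrable_excess s iW).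
apply: filterS ZW => w ZW _; rewrite lee_fin.
by rewrite ge_max !le_max lerD2r ZW lexx orbT.
Qed.

Lemma mean_cst t : \int[P]_w (cst t w) = t.
Proof.
have PT : (P : {measure set T -> \bar R}) [set: T] = 1%E by exact: probability_setT.
by rewrite Rintegral_cst// PT mulr1.
Qed.

(* Bounds the infimum in [top_integral] from below. *)
Lemma le_mean_excess a Z s : integrable Z -> 0 <= a <= 1 ->
  a * \int[P]_w Z w <= a * s + excess_mean Z s.
Proof.
move=> iZ /andP[a0 a1]; rewrite -lerBlDl -mulrBr.
rewrite -[X in a * (_ - X)](mean_cst s).
rewrite -RintegralB//; last exact: integrable_EFin_cst.
rewrite -RintegralZl//; last first.
  exact: integrable_EFinD iZ (integrable_EFin_cst (- s)).
apply: le_Rintegral => //.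
- exact/integrable_EFinZ/(integrable_EFinD iZ)/(integrable_EFin_cst (- s)).
- exact: integrable_excess.
move=> w _; rewrite -[cst s w]/s le_max; have [Zs|Zs] := leP s (Z w).
  by rewrite ler_piMl// subr_ge0.
by rewrite mulr_ge0_le0 ?orbT// subr_le0 ltW.
Qed.

Lemma top_integral_le a Z s : integrable Z -> 0 <= a <= 1 ->
  top_integral a Z <= a * s + excess_mean Z s.
Proof.
move=> iZ a01; rewrite /top_integral; case: eqP => [->|_].
  by rewrite mul0r add0r excess_mean_ge0.
apply: ge_inf; last by exists s.
by exists (a * \int[P]_w Z w) => _ [r _ <-]; exact: le_mean_excess.
Qed.

Lemma top_integral_ge a Z m : a != 0 ->
  (forall s, m <= a * s + excess_mean Z s) -> m <= top_integral a Z.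
Proof.
move=> a0 am; rewrite /top_integral (negbTE a0); apply: lb_le_inf.
  by exists (a * 0 + excess_mean Z 0), 0.
by move=> _ [s _ <-].
Qed.

Lemma top_integral_mono a Z W : 0 <= a <= 1 -> integrable Z -> integrable W ->
  {ae P, forall w, Z w <= W w} -> top_integral a Z <= top_integral a W.
Proof.
move=> a01 iZ iW ZW; have [->|a0] := eqVneq a 0.
  by rewrite /top_integral eqxx.
apply: top_integral_ge => // s; apply: (le_trans (top_integral_le s iZ a01)).
by rewrite lerD2l le_excess_mean_ae.
Qed.

Lemma excess_meanD Z b s : excess_mean (fun w => Z w + b) (s + b) = excess_mean Z s.
Proof. by apply: eq_Rintegral => w _; rewrite opprD addrACA subrr addr0. Qed.

Lemma top_integralD a Z b : 0 <= a <= 1 -> integrable Z ->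
  top_integral a (fun w => Z w + b) = top_integral a Z + a * b.
Proof.
move=> a01 iZ; have [->|a0] := eqVneq a 0.
  by rewrite /top_integral eqxx mul0r addr0.
have iZb : integrable (fun w => Z w + b).
  exact: integrable_EFinD iZ (integrable_EFin_cst b).
apply/eqP; rewrite eq_le; apply/andP; split.
  rewrite -lerBlDr; apply: top_integral_ge => // s.
  rewrite lerBlDr (le_trans (top_integral_le (s + b) iZb a01))//.
  by rewrite excess_meanD mulrDr addrAC.
apply: top_integral_ge => // s; rewrite -(subrK b s) excess_meanD mulrDr.
by rewrite addrAC lerD2r top_integral_le.
Qed.

Lemma excess_meanZ Z t s : 0 <= t -> integrable Z ->
  excess_mean (fun w => t * Z w) (t * s) = t * excess_mean Z s.
Proof.
move=> t0 iZ; rewrite -RintegralZl//; last exact: integrable_excess.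
by apply: eq_Rintegral => w _; rewrite maxr_pMr// mulr0 mulrBr.
Qed.

Lemma top_integral_cst0 a : 0 <= a <= 1 -> top_integral a (cst 0) = 0.
Proof.
move=> a01; have [->|a0] := eqVneq a 0; first by rewrite /top_integral eqxx.
have i0 := integrable_EFin_cst 0.
apply/eqP; rewrite eq_le; apply/andP; split.
  apply: (le_trans (top_integral_le 0 i0 a01)); rewrite mulr0 add0r.
  suff -> : excess_mean (fun=> 0) 0 = \int[P]_w (cst 0 w) by rewrite mean_cst.
  by apply: eq_Rintegral => w _; rewrite /= subrr maxxx.
apply: top_integral_ge => // s; apply: le_trans (le_mean_excess s i0 a01).
by rewrite mean_cst mulr0.
Qed.

Lemma top_integralZ a Z t : 0 <= a <= 1 -> 0 <= t -> integrable Z ->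
  top_integral a (fun w => t * Z w) = t * top_integral a Z.
Proof.
move=> a01; rewrite le_eqVlt => /predU1P[<- iZ|t0 iZ].
  rewrite mul0r -[RHS](top_integral_cst0 a01); congr top_integral.
  by apply/funext => w; rewrite mul0r.
have [->|a0] := eqVneq a 0; first by rewrite /top_integral eqxx mulr0.
have itZ : integrable (fun w => t * Z w) by exact: integrable_EFinZ.
apply/eqP; rewrite eq_le; apply/andP; split.
  rewrite mulrC -ler_pdivrMr//; apply: top_integral_ge => // s.
  rewrite ler_pdivrMr// (le_trans (top_integral_le (t * s) itZ a01))//.
  by rewrite excess_meanZ ?(ltW t0)// [leRHS]mulrC mulrDr (mulrCA a).
apply: top_integral_ge => // s.
have -> : s = t * (s / t) by rewrite mulrC divfK// gt_eqF.
rewrite excess_meanZ ?(ltW t0)// mulrCA -mulrDr ler_pM2l//.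
exact: top_integral_le.
Qed.

(** By homogeneity the weights move inside and subadditivity remains. Thresholds [r] and [s] for the
    two summands give [r + s] for the sum, since the positive part is subadditive. *)
Lemma top_integral_convex a Z W t : 0 <= a <= 1 -> 0 <= t <= 1 ->
  integrable Z -> integrable W ->
  top_integral a (fun w => t * Z w + (1 - t) * W w) <=
  t * top_integral a Z + (1 - t) * top_integral a W.
Proof.
move=> a01 /andP[t0 t1] iZ iW; rewrite -subr_ge0 in t1.
have [->|a0] := eqVneq a 0; first by rewrite /top_integral eqxx !mulr0 addr0.
rewrite -(top_integralZ a01 t0 iZ) -(top_integralZ a01 t1 iW).
set Z' := fun w => t * Z w; set W' := fun w => (1 - t) * W w.
have {iZ} iZ : integrable Z' by exact: integrable_EFinZ.
have {iW} iW : integrable W' by exact: integrable_EFinZ.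
rewrite -lerBlDr; apply: top_integral_ge => // r.
rewrite lerBlDr -lerBlDl; apply: top_integral_ge => // s; rewrite lerBlDl.
apply: (le_trans (top_integral_le (r + s) (integrable_EFinD iZ iW) a01)).
suff : excess_mean (fun w => Z' w + W' w) (r + s) <=
       excess_mean Z' r + excess_mean W' s by lra.
rewrite -RintegralD//; [|exact: integrable_excess|exact: integrable_excess].
apply: le_Rintegral => //.
- exact/integrable_excess/integrable_EFinD.
- by apply: integrable_EFinD; exact: integrable_excess.
move=> w _; rewrite ge_max addr_ge0 ?le_max ?lexx ?orbT// andbT.
by rewrite opprD addrACA lerD// le_max lexx.
Qed.

(** Midpoint concavity in the mass: for a fixed threshold the bound is affine in the mass, and an
    infimum of affine functions is concave. *)
Lemma top_integral_concave a b c Z : 0 <= a <= 1 -> 0 <= b <= 1 ->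
  0 < c -> a + b = c + c -> integrable Z ->
  top_integral a Z + top_integral b Z <= top_integral c Z + top_integral c Z.
Proof.
move=> a01 b01 c0 abc iZ; rewrite -mulr2n -mulr_natl -ler_pdivrMl//.
apply: top_integral_ge => [|s]; first by rewrite gt_eqF.
rewrite ler_pdivrMl//; have := top_integral_le s iZ a01.
by have := top_integral_le s iZ b01; nra.
Qed.

(** Layer-cake formula: for [r >= 0] the excess is above [r] exactly when the variable is above
    [r + s], so its mean depends only on the cdf. *)
Lemma eq_cdf_excess_mean (X Y : {RV P >-> R}) s : cdf X = cdf Y ->
  excess_mean X s = excess_mean Y s.
Proof.
move=> XY.
have mE (Z : {RV P >-> R}) : measurable_fun setT (fun w => Num.max (Z w - s) 0).
  by apply: measurable_maxr => //; exact: measurable_funB.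
pose E (Z : {RV P >-> R}) := mfun_Sub (mem_set (mE Z)) : {RV P >-> R}.
have EE (Z : {RV P >-> R}) : excess_mean Z s = fine ('E_P[E Z])%E.
  by rewrite unlock.
rewrite !EE !ge0_expectation_ccdf; last 2 first.
- by move=> w /=; rewrite le_max lexx orbT.
- by move=> w /=; rewrite le_max lexx orbT.
congr fine; apply: eq_integral => r; rewrite inE/= in_itv/= andbT => r0.
have H (Z : {RV P >-> R}) : ccdf (E Z) r = ccdf Z (r + s).
  congr (P _); apply/seteqP; split => w /=; rewrite !in_itv/= !andbT lt_max.
    by rewrite ltrBrDr => /orP[//|]; rewrite ltNge r0.
  by rewrite ltrBrDr => ->.
by rewrite !H !ccdf_1_cdf XY.
Qed.

Lemma eq_cdf_top_integral a (X Y : {RV P >-> R}) : cdf X = cdf Y ->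
  top_integral a X = top_integral a Y.
Proof.
move=> XY; rewrite /top_integral; case: ifP => // _.
have -> // : excess_mean X = excess_mean Y.
by apply/funext => s; exact: eq_cdf_excess_mean.
Qed.

End TopIntegral.

(** * Sigma-algebras generated by an equipartition *)

Lemma exists_nonincreasing_perm (R : realDomainType) n (v : 'I_n -> R) :
  exists s : {perm 'I_n}, {homo v \o s : i j / (i <= j)%N >-> j <= i}.
Proof.
pose t := [tuple v i | i < n].
have /tuple_permP[s ts] : perm_eq (sort_tuple >=%R t) t by rewrite perm_sort.
exists s => i j ij.
have vE (k : 'I_n) : v (s k) = nth 0 (sort >=%R t) k.
  by rewrite ts -(tnth_nth 0 [tuple tnth t (s i) | i < n]) !tnth_mktuple.
have tot : total (>=%R : rel R) by move=> a b; exact: le_total.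
rewrite /= !vE; apply: (sorted_leq_nth ge_trans ge_refl 0 (sort_sorted tot t)) => //.
- by rewrite inE size_sort size_tuple.
- by rewrite inE size_sort size_tuple.
Qed.

Section Equipartition.
Context d (T : measurableType d) (R : realType) (P : probability T R).
Context (n : nat) (n0 : (0 < n)%N) (I : T -> 'I_n).
Context (mI : forall i, measurable (I @^-1` [set i])).
Context (PI : forall i, P (I @^-1` [set i]) = (n%:R^-1)%:E).

Lemma comp_equipartitionE (v : 'I_n -> R) w :
  v (I w) = \sum_i v i * \1_(I @^-1` [set i]) w.
Proof.
rewrite (bigD1 (I w))//= big1 => [|i iw].
  by rewrite indicE mem_set// mulr1 addr0.
by rewrite indicE memNset ?mulr0// => iw'; move: iw; rewrite -iw' eqxx.
Qed.

Lemma integrable_equipartition (v : 'I_n -> R) :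
  P.-integrable setT (EFin \o (v \o I)).
Proof.
have -> : EFin \o (v \o I) =
    (fun w => \sum_i (v i)%:E * (\1_(I @^-1` [set i]) w)%:E)%E.
  by apply/funext => w; rewrite /= comp_equipartitionE sumEFin.
apply: integrable_sum => // i _; apply: integrableZl => //.
exact: integrable_indic.
Qed.

Lemma measurable_equipartition (v : 'I_n -> R) : measurable_fun setT (v \o I).
Proof.
have -> : v \o I = (fun w => \sum_i v i * \1_(I @^-1` [set i]) w).
  by apply/funext => w; exact: comp_equipartitionE.
by apply: measurable_sum => i; apply: measurable_funM => //; exact: measurable_indic.
Qed.

Lemma integral_comp_equipartition (g : 'I_n -> R) :
  (\int[P]_w (g (I w))%:E = (n%:R^-1 * \sum_i g i)%:E)%E.
Proof.
rewrite (eq_integral (fun w => \sum_i (g i)%:E * (\1_(I @^-1` [set i]) w)%:E)%E).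
  rewrite integral_sum//=; last first.
    by move=> i; apply: integrableZl => //; exact: integrable_indic.
  rewrite mulr_sumr -sumEFin; apply: eq_bigr => i _.
  rewrite integralZl//; last exact: integrable_indic.
  rewrite integral_indic// setIT mulrC EFinM; congr (_ * _)%E; exact: PI.
by move=> w _; rewrite (comp_equipartitionE g) -sumEFin.
Qed.

Lemma prob_comp_equipartition (v : 'I_n -> R) (B : set R) : measurable B ->
  P ((v \o I) @^-1` B) = (n%:R^-1 * \sum_i \1_B (v i))%:E.
Proof.
move=> mB; rewrite -(integral_comp_equipartition (fun i => \1_B (v i))).
have mvB : measurable ((v \o I) @^-1` B).
  by rewrite -[X in measurable X]setTI; exact: measurable_equipartition.
have := integral_indic P measurableT mvB; rewrite setIT => <-.
by apply: eq_integral.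
Qed.

Lemma excess_mean_equipartition (v : 'I_n -> R) s :
  excess_mean P (v \o I) s = n%:R^-1 * \sum_i Num.max (v i - s) 0.
Proof.
by rewrite /excess_mean /Rintegral
  (integral_comp_equipartition (fun i => Num.max (v i - s) 0)).
Qed.

Lemma natr_div01 k : (k <= n)%N -> 0 <= (k%:R / n%:R : R) <= 1.
Proof.
move=> kn; rewrite divr_ge0//= ler_pdivrMr ?ltr0n// mul1r ler_nat//.
Qed.

Lemma top_integral_equipartition (v : 'I_n -> R) (s : {perm 'I_n}) k :
  {homo v \o s : i j / (i <= j)%N >-> j <= i} -> (k <= n)%N ->
  top_integral P (k%:R / n%:R) (v \o I) =
  n%:R^-1 * \sum_(i < n | (i < k)%N) v (s i).
Proof.
move=> vs; case: k => [_|k kn].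
  by rewrite mul0r /top_integral eqxx big_pred0 ?mulr0.
have nR0 : 0 < n%:R^-1 :> R by rewrite invr_gt0 ltr0n.
have exE r : (k.+1%:R / n%:R) * r + excess_mean P (v \o I) r =
    n%:R^-1 * (\sum_(i < n | (i < k.+1)%N) r + \sum_i Num.max (v (s i) - r) 0).
  rewrite excess_mean_equipartition mulrDr; congr (_ + _); last first.
    by rewrite [in LHS](reindex_inj (h := s) perm_inj).
  rewrite -(big_ord_widen n (fun=> r) kn) sumr_const card_ord.
  by rewrite -[r *+ _]mulr_natr [RHS]mulrCA mulrC [_ * n%:R^-1]mulrC.
apply/eqP; rewrite eq_le; apply/andP; split.
  (* The optimal threshold is the smallest of the [k.+1] largest values: excesses vanish below it
     and the threshold cancels above it. *)
  have := top_integral_le (v (s (Ordinal kn)))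
    (integrable_equipartition v) (natr_div01 kn).
  move=> /le_trans; apply; rewrite exE ler_pM2l//.
  rewrite [X in _ + X](bigID (fun i : 'I_n => (i < k.+1)%N))/=.
  rewrite [X in _ + (_ + X)]big1 => [|i]; last first.
    rewrite -leqNgt => ki; apply/max_idPr; rewrite subr_le0.
    by apply: vs; exact: ltnW.
  rewrite addr0 -big_split/= le_eqVlt; apply/orP; left; apply/eqP/eq_bigr => i ik.
  by rewrite (max_idPl _) ?subrKC// subr_ge0; apply: vs.
apply: top_integral_ge => [|r].
  by rewrite mulf_neq0// ?pnatr_eq0// gt_eqF.
(* For any threshold, the positive part is at least [v - r] on the top indices and at least 0 on the
   rest. *)
rewrite exE ler_pM2l// [X in _ + X](bigID (fun i : 'I_n => (i < k.+1)%N))/=.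
rewrite addrA -big_split/= -[leLHS]addr0 lerD//.
  by apply: ler_sum => i _; rewrite -lerBlDl le_max lexx.
by apply: sumr_ge0 => i _; rewrite le_max lexx orbT.
Qed.

End Equipartition.

(** * Membership in L_p, a.e. equality and equality of laws *)

Lemma Lfun_bounded d (T : measurableType d) (R : realType)
    (P : probability T R) (q : \bar R) (f : T -> R) (M : R) :
  (1 <= q)%E -> measurable_fun setT f -> (forall w, `|f w| <= M) ->
  f \in Lfun P q.
Proof.
move=> q1 mf fM.
have PT : (P : {measure set T -> \bar R}) [set: T] = 1%E by exact: probability_setT.
(* Over a probability measure, L_oo is contained in L_q. *)
apply: (@Lfun_subset _ _ _ P q +oo%E) => //; rewrite ?leey ?PT//.
rewrite inE; apply/andP; split; rewrite inE//= /finite_norm unlock PT lte01.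
apply: (@le_lt_trans _ _ M%:E); last exact: ltry.
by rewrite ess_supEae; apply: ereal_inf_lbound; apply: aeW => w /=; rewrite lee_fin.
Qed.

Lemma Lfun_ge1_integrable d (T : measurableType d) (R : realType)
    (P : probability T R) (p : R) (f : T -> R) :
  1 <= p -> f \in Lfun P p%:E -> P.-integrable setT (EFin \o f).
Proof.
move=> p1 fp; apply/Lfun1_integrable.
have PT : (P : {measure set T -> \bar R}) [set: T] = 1%E by exact: probability_setT.
by apply: (@Lfun_subset _ _ _ P 1%E p%:E) => //; rewrite PT.
Qed.

Lemma crm_ae_eq d (T : measurableType d) (R : realType) (P : probability T R)
    (X : set (T -> R)) rho Z Z' : coherent_risk_measure P X rho ->
  X Z -> X Z' -> {ae P, forall w, Z w = Z' w} -> rho Z = rho Z'.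
Proof.
move=> crm XZ XZ' ZZ'; apply/eqP; rewrite eq_le; apply/andP; split.
  by apply: (crm_monotone crm) => //; apply: filterS ZZ' => w ->.
by apply: (crm_monotone crm) => //; apply: filterS ZZ' => w ->.
Qed.

(** [law_invariant] speaks of bundled random variables; this form takes bare functions with separate
    measurability proofs. *)
Lemma law_invariant_mfun d (T : measurableType d) (R : realType)
    (P : probability T R) (X : set (T -> R)) rho Z1 Z2 :
  law_invariant P X rho -> X Z1 -> X Z2 ->
  measurable_fun setT Z1 -> measurable_fun setT Z2 ->
  (forall r, P (Z1 @^-1` `]-oo, r]) = P (Z2 @^-1` `]-oo, r])) ->
  rho Z1 = rho Z2.
Proof.
move=> li X1 X2 m1 m2 PE.
apply: (li (mfun_Sub (mem_set m1)) (mfun_Sub (mem_set m2)) X1 X2).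
by apply/funext => r; exact: PE.
Qed.

(** * Extension of a risk measure from an equipartition *)

Section RegularEquipartition.
Context d (T : measurableType d) (R : realType) (P : probability T R).
Context (n : nat) (n0 : (0 < n)%N) (I : T -> 'I_n).
Context (mI : forall i, measurable (I @^-1` [set i])).
Context (PI : forall i, P (I @^-1` [set i]) = (n%:R^-1)%:E).

(** The vector x(Z): increments of the tail integral over steps of mass [1/n], divided by that mass,
    are means of the quantile function taken from the top. *)
Definition top_means (Z : T -> R) (i : 'I_n) : R := n%:R *
  (top_integral P (i.+1%:R / n%:R) Z - top_integral P (i%:R / n%:R) Z).

Local Notation integrable Z := (P.-integrable [set: T] (EFin \o Z)).

Lemma sum_top_means Z k :
  \sum_(i < n | (i < k)%N) top_means Z i =
  n%:R * top_integral P ((minn k n)%:R / n%:R) Z.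
Proof.
rewrite (eq_bigl (fun i : 'I_n => (i < minn k n)%N)); last first.
  by move=> i; rewrite leq_min ltn_ord andbT.
pose F i := n%:R * top_integral P (i%:R / n%:R) Z.
rewrite -(big_ord_widen n (fun i => n%:R * (top_integral P (i.+1%:R / n%:R) Z
  - top_integral P (i%:R / n%:R) Z)) (geq_minr _ _)).
rewrite -(big_mkord xpredT (fun i => n%:R * (top_integral P (i.+1%:R / n%:R) Z
  - top_integral P (i%:R / n%:R) Z))).
under eq_bigr do rewrite mulrBr.
(* The sum telescopes down to mass 0, where [top_integral] is 0 by definition. *)
by rewrite (telescope_sumr F)// /F mul0r {2}/top_integral eqxx mulr0 subr0.
Qed.

(** The tail integral is concave in the mass, so its increments over successive equal steps
    decrease; induction reduces to adjacent steps. *)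
Lemma top_means_nonincreasing Z : integrable Z ->
  {homo top_means Z : i j / (i <= j)%N >-> j <= i}.
Proof.
move=> iZ [i iltn] [j jltn] /= ij.
rewrite /top_means/= ler_pM2l ?ltr0n//.
rewrite -(subnKC ij) in jltn *.
elim: (j - i)%N jltn => [|m IH] mn; first by rewrite addn0.
rewrite addnS; apply: le_trans (IH _); last by apply: ltn_trans mn; rewrite addnS.
have nR0 : (n%:R : R) != 0 by rewrite pnatr_eq0 -lt0n.
rewrite addnS in mn.
have := @top_integral_concave _ _ _ P ((i + m)%N%:R / n%:R) ((i + m).+2%:R / n%:R)
  ((i + m).+1%:R / n%:R) Z.
rewrite !natr_div01//; last exact: ltnW (ltnW mn).
move=> /(_ isT isT); rewrite divr_gt0 ?ltr0n// => /(_ isT).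
have -> : (i + m)%:R / n%:R + (i + m).+2%:R / n%:R =
    (i + m).+1%:R / n%:R + (i + m).+1%:R / n%:R :> R.
  by rewrite -!mulrDl -!natrD addnS addSn.
by move=> /(_ erefl iZ); lra.
Qed.

(** Each increment of the tail integral picks out the next largest value, so the permutation is the
    one that sorts [v]. *)
Lemma top_means_equipartition (v : 'I_n -> R) :
  exists s : {perm 'I_n}, top_means (v \o I) = v \o s.
Proof.
have [s vs] := exists_nonincreasing_perm v; exists s; apply/funext => i.
have nR0 : (n%:R : R) != 0 by rewrite pnatr_eq0 -lt0n.
rewrite /top_means !(top_integral_equipartition n0 mI PI vs)//; last exact: ltnW.
rewrite -mulrBr mulVKf// (bigD1 i)//= (eq_bigl (fun j : 'I_n => (j < i)%N)).
  by rewrite addrK.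
by move=> j; rewrite ltnS ltn_neqAle andbC.
Qed.

Lemma regular_of_equipartition G p vrho : 1 <= p ->
  (forall v : 'I_n -> R, sub_Lp_space P G p%:E (v \o I)) ->
  (forall Z, sub_Lp_space P G p%:E Z ->
    exists v : 'I_n -> R, {ae P, forall w, Z w = v (I w)}) ->
  coherent_risk_measure P (sub_Lp_space P G p%:E) vrho ->
  law_invariant P (sub_Lp_space P G p%:E) vrho ->
  regular_risk_measure P G p%:E vrho.
Proof.
move=> p1 Xv XE crm li; pose f (v : 'I_n -> R) := vrho (v \o I).
have Lp_int Z : Lp_space P p%:E Z -> integrable Z by exact: Lfun_ge1_integrable.
(* All cells have the same probability, so permuting the values keeps the law. *)
have fperm v (s : {perm 'I_n}) : f (v \o s) = f v.
  apply: (law_invariant_mfun li).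
  - exact: Xv.
  - exact: Xv.
  - exact: (measurable_equipartition mI).
  - exact: (measurable_equipartition mI).
  move=> r; rewrite !(prob_comp_equipartition mI PI)//.
  by rewrite [in RHS](reindex_inj (h := s) perm_inj).
have fmono u v : (forall i, u i <= v i) -> f u <= f v.
  by move=> uv; apply: (crm_monotone crm) => //; apply: aeW => w; exact: uv.
have fconv u v t : 0 <= t <= 1 ->
    f (fun i => t * u i + (1 - t) * v i) <= t * f u + (1 - t) * f v.
  by move=> t01; exact: (crm_convex crm (Xv u) (Xv v) t01).
(* [top_means Z] is nonincreasing, so majorization compares it with [v] through tail integrals
   alone; monotonicity and convexity of the extension both come from this. *)
have fmajo Z v : integrable Z ->
    (forall k, (k <= n)%N -> n%:R * top_integral P (k%:R / n%:R) Z <=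
       \sum_(i < n | (i < k)%N) v i) -> f (top_means Z) <= f v.
  move=> iZ Zv; apply: (majorization_le fmono fperm fconv).
    exact: top_means_nonincreasing.
  move=> k; rewrite sum_top_means.
  rewrite [leRHS](eq_bigl (fun i : 'I_n => (i < minn k n)%N)).
    by apply: Zv; exact: geq_minr.
  by move=> i; rewrite leq_min ltn_ord andbT.
have sumE Z k : (k <= n)%N ->
    \sum_(i < n | (i < k)%N) top_means Z i = n%:R * top_integral P (k%:R / n%:R) Z.
  by move=> kn; rewrite sum_top_means (minn_idPl kn).
exists (f \o top_means); split.
- split.
  + move=> Z Z' /Lp_int iZ /Lp_int iZ' Z'Z; apply: fmajo => // k kn.
    by rewrite sumE// ler_wpM2l// top_integral_mono// natr_div01.
  + move=> Z Z' t /Lp_int iZ /Lp_int iZ' t01.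
    apply: le_trans (fconv _ _ _ t01); apply: fmajo => [|k kn].
      by apply: integrable_EFinD; exact: integrable_EFinZ.
    rewrite big_split/= -[X in _ <= X + _]mulr_sumr -[X in _ <= _ + X]mulr_sumr.
    rewrite !sumE// [X in _ <= X + _]mulrCA [X in _ <= _ + X]mulrCA -mulrDr.
    by rewrite ler_wpM2l// top_integral_convex// natr_div01.
  + move=> Z a /Lp_int iZ /=; rewrite -(crm_translation crm a (Xv (top_means Z))).
    congr vrho; apply/funext => w; rewrite /= /top_means.
    rewrite !top_integralD ?natr_div01 ?(ltnW (ltn_ord _))//.
    by rewrite -natr1; field; rewrite pnatr_eq0 -lt0n.
  + move=> Z t /Lp_int iZ t0 /=; rewrite -(crm_homogeneous crm (Xv (top_means Z)) t0).
    congr vrho; apply/funext => w; rewrite /= /top_means.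
    by rewrite !top_integralZ ?natr_div01 ?(ltnW (ltn_ord _))//; ring.
- move=> Z1 Z2 _ _ Z12 /=; congr f; apply/funext => i.
  by rewrite /top_means !(eq_cdf_top_integral _ Z12).
(* On the subspace, [Z] is a.e. [v \o I]; its quantile means are a permutation of [v], which the
   symmetric [f] does not see. *)
move=> Z XZ; have [v Zv] := XE Z XZ.
have ivI : integrable (v \o I) by exact: Lp_int (Xv v).1.
have iZ := Lp_int _ XZ.1.
have [s vs] := top_means_equipartition v.
have vZ : {ae P, forall w, v (I w) = Z w} by apply: filterS Zv => w ->.
rewrite (crm_ae_eq crm XZ (Xv v) Zv) -[RHS](fperm v s) -vs /=; congr f.
apply/funext => i; rewrite /top_means.
have tE a : 0 <= a <= 1 -> top_integral P a Z = top_integral P a (v \o I).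
  move=> a01; apply/eqP; rewrite eq_le !top_integral_mono//.
    by apply: filterS vZ => w /= ->.
  by apply: filterS Zv => w /= ->.
by rewrite !tE ?natr_div01// ltnW.
Qed.

End RegularEquipartition.

(** * Sub-sigma-algebras containing all events up to null sets *)

Section AlmostEverywhere.
Context d (T : measurableType d) (R : realType) (P : probability T R).
Implicit Types A B : set T.

Lemma le_probability_ae A B : measurable A -> measurable B ->
  {ae P, forall w, A w -> B w} -> (P A <= P B)%E.
Proof.
move=> mA mB [N [mN PN AB]]; have mBN := measurableU _ _ mB mN.
apply: (@le_trans _ _ (P (B `|` N))).
  apply: le_measure; rewrite ?inE// => w Aw.
  by have [Bw|Bw] := pselect (B w); [left|right; apply: AB => /(_ Aw)].
apply: (le_trans (measureU2 _ mB mN)).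
by rewrite [X in (_ + X)%E](_ : _ = 0%E) ?adde0//; exact: PN.
Qed.

Lemma eq_probability_ae A B : measurable A -> measurable B ->
  {ae P, forall w, A w <-> B w} -> P A = P B.
Proof.
move=> mA mB AB; apply/eqP; rewrite eq_le !le_probability_ae//.
  by apply: filterS AB => w [].
by apply: filterS AB => w [].
Qed.

Lemma ae_notP A : measurable A -> {ae P, forall w, ~ A w} <-> P A = 0%E.
Proof.
by move=> mA; rewrite -(negligibleP P mA) -[in X in _ <-> X](setCK A).
Qed.

(** The constant is the infimum of the [c] with [Z <= c] a.e. on [B]; since [B] is not negligible,
    this set is nonempty and bounded below. *)
Lemma ae_cst_of_dichotomy B (Z : T -> R) :
  (forall c, {ae P, forall w, B w -> Z w <= c} \/
             {ae P, forall w, B w -> c < Z w}) ->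
  ~ {ae P, forall w, ~ B w} ->
  exists z, {ae P, forall w, B w -> Z w = z}.
Proof.
move=> dich B0; pose S := [set c | {ae P, forall w, B w -> Z w <= c}].
have upS c c' : c <= c' -> S c -> S c'.
  by move=> cc'; apply: filterS => w /[apply] /le_trans; exact.
have S0 : S !=set0.
  apply: contrapT => /nonemptyPn/seteqP[S0 _]; apply: B0.
  have : {ae P, forall w, forall k, B w -> k%:R < Z w}.
    by apply/ae_foralln => k; have [/S0//|] := dich k%:R.
  apply: filterS => w Bw /Bw kZ; have := kZ (Num.truncn (Z w)).+1.
  by rewrite ltNge ltW// truncnS_gt.
have lbS : has_lbound S.
  apply: contrapT => nlb; apply: B0.
  have : {ae P, forall w, forall k, B w -> Z w <= - k%:R}.
    apply/ae_foralln => k; apply: contrapT => nS; apply: nlb; exists (- k%:R) => c Sc.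
    by rewrite leNgt; apply/negP => /ltW ck; exact/nS/(upS _ _ ck).
  apply: filterS => w Bw /Bw kZ; have := kZ (Num.truncn (- Z w)).+1.
  by rewrite lerNr leNgt truncnS_gt.
exists (inf S).
have le1 : {ae P, forall w, forall k, B w -> Z w <= inf S + k.+1%:R^-1}.
  apply/ae_foralln => k; have k0 : 0 < k.+1%:R^-1 :> R by rewrite invr_gt0.
  have [c Sc cS] := inf_adherent k0 (conj S0 lbS).
  by move: Sc; exact/upS/ltW.
(* A number below the infimum is not in [S], so the other alternative holds there. *)
have ge1 : {ae P, forall w, forall k, B w -> inf S - k.+1%:R^-1 < Z w}.
  apply/ae_foralln => k; have [Sk|//] := dich (inf S - k.+1%:R^-1).
  have := ge_inf lbS Sk; rewrite lerBrDr gerDl leNgt invr_gt0.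
  by rewrite ltr0n.
apply: filterS2 le1 ge1 => w le1 ge1 Bw; apply/eqP; rewrite eq_le; apply/andP; split.
  rewrite leNgt; apply/negP => /ltr_add_invr[k]; rewrite ltNge => /negP; apply.
  exact: le1.
rewrite leNgt; apply/negP => /ltr_add_invr[k]; rewrite ltNge => /negP; apply.
by rewrite -lerBlDr; exact/ltW/ge1.
Qed.

(** [Z \o U] is [Z] up to a null set, with the same law and norm, and lies in the domain of
    [vrho]. *)
Lemma regular_of_ae_id (G : set (set T)) (p : R) vrho (U : T -> T) : 1 <= p ->
  G `<=` measurable ->
  (forall A, measurable A -> G (U @^-1` A)) -> {ae P, forall w, U w = w} ->
  coherent_risk_measure P (sub_Lp_space P G p%:E) vrho ->
  law_invariant P (sub_Lp_space P G p%:E) vrho ->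
  regular_risk_measure P G p%:E vrho.
Proof.
move=> p1 GF GU Uid crm li.
have mcomp (Z : T -> R) : measurable_fun setT Z -> measurable_fun setT (Z \o U).
  move=> mZ _ B mB; rewrite setTI; apply: GF.
  by apply: (GU (Z @^-1` B)); rewrite -[X in measurable X]setTI; exact: mZ.
have XU Z : Lp_space P p%:E Z -> sub_Lp_space P G p%:E (Z \o U).
  rewrite /Lp_space/= inE => /andP[/[!inE]/= mZ fZ]; split; last first.
    move=> B mB; apply: (GU (Z @^-1` B)).
    by rewrite -[X in measurable X]setTI; exact: mZ.
  rewrite /Lp_space/= inE; apply/andP; split; rewrite inE/=; first exact: mcomp.
  apply: le_lt_trans fZ; rewrite le_eqVlt; apply/orP; left; apply/eqP.
  rewrite unlock /Lnorm; congr (_ `^ _)%E.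
  have mn (f : T -> R) : measurable_fun setT f ->
      measurable_fun setT (fun w => `|(EFin \o f) w| `^ p)%E.
    move=> mf; apply: (measurableT_comp (measurable_poweR _)) => //.
    by apply: measurableT_comp => //; exact/measurable_EFinP.
  apply: ge0_ae_eq_integral => //.
  - exact/mn/mcomp.
  - exact: mn.
  - by move=> w _; rewrite poweR_ge0.
  - by move=> w _; rewrite poweR_ge0.
  by apply: filterS Uid => w /= ->.
exists (fun Z => vrho (Z \o U)); split.
- split.
  + move=> Z Z' /XU XZ /XU XZ' Z'Z; apply: (crm_monotone crm) => //.
    by apply: filterS2 Z'Z Uid => w Z'Z /= ->.
  + by move=> Z Z' t /XU XZ /XU XZ' t01; exact: (crm_convex crm XZ XZ' t01).
  + by move=> Z a /XU XZ; exact: (crm_translation crm a XZ).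
  + by move=> Z t /XU XZ t0; exact: (crm_homogeneous crm XZ t0).
- move=> Z1 Z2 /XU X1 /XU X2 Z12; apply: (law_invariant_mfun li) => //.
  + exact: mcomp.
  + exact: mcomp.
  move=> r; have UE (Z : {RV P >-> R}) : P ((Z \o U) @^-1` `]-oo, r]) = cdf Z r.
    apply: eq_probability_ae.
    - by rewrite -[X in measurable X]setTI; exact: mcomp.
    - by rewrite -[X in measurable X]setTI; exact: measurable_funPT.
    by apply: filterS Uid => w /= ->.
  by rewrite !UE Z12.
move=> Z XZ; apply: (crm_ae_eq crm) => //; first exact: XU XZ.1.
by apply: filterS Uid => w /= ->.
Qed.

End AlmostEverywhere.

(** * The dichotomy for sub-sigma-algebras of the unit interval *)

Section Uniform01.
Context (R : realType).
Local Notation P := (uniform01 R).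
Implicit Types (w : Omega R) (s t : R).

Lemma Omega_val01 w : 0 <= Omega_val w <= 1.
Proof. by have := svalP w; rewrite in_itv. Qed.

Lemma measurable_Omega_val : measurable_fun setT (@Omega_val R).
Proof. by move=> _ B mB; exists B. Qed.

Lemma measurable_Omega_lt s : measurable [set w : Omega R | Omega_val w < s].
Proof.
rewrite -[X in measurable X]setTI.
have -> : [set w : Omega R | Omega_val w < s] = Omega_val @^-1` `]-oo, s[.
  by apply/seteqP; split => w /=; rewrite in_itv.
exact: measurable_Omega_val.
Qed.

Lemma measurable_Omega_ico s t :
  measurable [set w : Omega R | s <= Omega_val w < t].
Proof.
rewrite -[X in measurable X]setTI.
have -> : [set w : Omega R | s <= Omega_val w < t] = Omega_val @^-1` `[s, t[.
  by apply/seteqP; split => w /=; rewrite in_itv.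
exact: measurable_Omega_val.
Qed.

Lemma uniform01_ico s t : 0 <= s -> s <= t -> t <= 1 ->
  P [set w | s <= Omega_val w < t] = (t - s)%:E.
Proof.
move=> s0 st t1; rewrite -[LHS]/(lebesgue_measure (Omega_val @` _)).
have -> : Omega_val @` [set w : Omega R | s <= Omega_val w < t] = `[s, t[%classic.
  apply/seteqP; split => [_ [w wst <-]|x]; rewrite /= in_itv//= => /andP[sx xt].
  have x01 : x \in `[0, 1].
    by rewrite in_itv/= (le_trans s0 sx) (ltW (lt_le_trans xt t1)).
  by exists (exist _ x x01) => //=; rewrite /Omega_val/= sx.
rewrite lebesgue_measure_itv/= lte_fin; case: ltP => [//|ts].
by have -> : s = t; [apply/eqP; rewrite eq_le st|rewrite subrr].
Qed.

Lemma uniform01_lt s : 0 <= s <= 1 -> P [set w | Omega_val w < s] = s%:E.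
Proof.
move=> /andP[s0 s1]; rewrite -[in RHS](subr0 s) -uniform01_ico//.
suff -> : [set w : Omega R | Omega_val w < s] = [set w | 0 <= Omega_val w < s] by [].
apply/seteqP; split => w /=; last by move=> /andP[].
by have /andP[-> _] := Omega_val01 w.
Qed.

Lemma ae_Omega_neq s : {ae P, forall w, Omega_val w != s}.
Proof.
have mE : measurable [set w : Omega R | Omega_val w = s].
  rewrite -[X in measurable X]setTI.
  exact: (measurable_Omega_val measurableT (measurable_set1 s)).
have : P [set w | Omega_val w = s] = 0%E.
  rewrite -[LHS]/(lebesgue_measure (Omega_val @` _)).
  apply/eqP; rewrite -measure_le0 -(lebesgue_measure_set1 s).
  apply: le_measure; rewrite ?inE//; first exact: measurable_image_Omega_val.
  by move=> _ [w /= <- <-].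
move=> /(ae_notP (uniform01 R : probability _ R) mE).
by apply: filterS => w /= /eqP.
Qed.

End Uniform01.

(** * Closure properties of a sub-sigma-algebra *)

Section SubSigmaAlgebra.
Context (T : pointedType) (G : set (set T)).
Context (sG : sigma_algebra [set: T] G).

(** Viewing [G] as the measurable sets of a measurable type makes the general measurability lemmas
    apply to [G]. *)
Lemma sub_measurableE (A : set (g_sigma_algebraType G)) : measurable A = G A.
Proof. by rewrite /measurable/= sigma_algebra_id. Qed.

Lemma sub_algebra_set0 : G set0.
Proof. by rewrite -sub_measurableE; exact: measurable0. Qed.

Lemma sub_algebra_setT : G setT.
Proof. by rewrite -sub_measurableE; exact: measurableT. Qed.

Lemma sub_algebra_setD A B : G A -> G B -> G (A `\` B).
Proof. by rewrite -!sub_measurableE; exact: measurableD. Qed.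

Lemma sub_algebra_setI A B : G A -> G B -> G (A `&` B).
Proof. by rewrite -!sub_measurableE; exact: measurableI. Qed.

End SubSigmaAlgebra.

(** * Initial intervals that belong to [G] up to null sets *)

Section Levels.
Context (R : realType) (q : \bar R) (q1 : (1 <= q)%E).
Local Notation P := (uniform01 R).
Context (G : set (set (Omega R))) (sG : sigma_algebra [set: Omega R] G).
Context (GF : G `<=` measurable).
Context (hG : forall eta : Omega R -> R,
    sub_Lp_space (uniform01 R) G q eta ->
    {ae uniform01 R, forall w, 0 <= eta w} ->
    exists (zeta : R -> R) (T : Omega R -> Omega R),
      [/\ {in `[0, 1[ &, {homo zeta : s t / s <= t}},
          {in `[0, 1[, forall t, zeta x @[x --> t^'+] --> zeta t},
          preserving_transformations (uniform01 R) G T &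
          {ae uniform01 R, forall w, eta w = zeta (Omega_val (T w))}]).
Implicit Types (w : Omega R) (s t : R).

Definition level s := exists2 C, G C & {ae P, forall w, C w <-> Omega_val w < s}.

Lemma sub_Lp_indic A : G A -> sub_Lp_space P G q (\1_A : Omega R -> R).
Proof.
move=> GA; split=> [|B mB].
  apply: (@Lfun_bounded _ _ _ _ _ _ 1) => //.
    by apply: measurable_indic; exact: GF.
  by move=> w; rewrite ger0_norm// indicE; case: (_ \in _).
rewrite -(sub_measurableE sG) -[X in measurable X]setTI.
have mA : measurable (A : set (g_sigma_algebraType G)) by rewrite sub_measurableE.
exact: (measurable_indic (D := setT) mA).
Qed.

(** The function [zeta] is a.e. 0 on T(A) and 1 off it, so monotonicity makes T(A) an initial
    interval; its length is [P A] because [T] preserves probability. *)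
Lemma level_prob A : G A -> level (fine (P A)).
Proof.
move=> GA; have GAC : G (~` A) by case: sG => _ + _ => /(_ A GA); rewrite setTD.
have [|zeta [T [zhomo _ [[Tbij TP] TG]]]] := hG (sub_Lp_indic GAC).
  by apply: aeW => w; rewrite indicE ler0n.
move=> [N [mN PN zN]].
have Tinj w w' : T w = T w' -> w = w'.
  by move=> ?; apply: (set_bij_inj Tbij); rewrite ?inE.
have [mTN PTN] := TP N mN.
have {}zN w : ~ N w -> \1_(~` A) w = zeta (Omega_val (T w)).
  by move=> Nw; apply: contrapT => h; exact/Nw/zN.
have aeM : {ae P, forall y, ~ (T @` N) y} by apply/(ae_notP P mTN); rewrite PTN.
have zC y : ~ (T @` N) y ->
    ((T @` A) y -> zeta (Omega_val y) = 0) /\ (~ (T @` A) y -> zeta (Omega_val y) = 1).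
  have [w _ <-] := set_bij_surj Tbij (I : [set: Omega R] y) => TNw.
  have Nw : ~ N w by move=> Nw; apply: TNw; exists w.
  rewrite -zN// indicE; split => [[w' Aw' /Tinj ww']|nA].
    by rewrite -ww' memNset//= => /(_ Aw').
  by rewrite mem_set// => Aw; apply: nA; exists w.
(* [S] omits the null set T(N) and the point 1, since [zeta] is monotone only on [0, 1). *)
pose S := Omega_val @` [set y | [/\ (T @` A) y, ~ (T @` N) y & Omega_val y != 1]].
have S01 x : S x -> 0 <= x <= 1 by move=> [y _ <-]; exact: Omega_val01.
have lt1 (y : Omega R) : Omega_val y != 1 -> Omega_val y \in `[0, 1[.
  by have /andP[y0 y1] := Omega_val01 y => yn1; rewrite in_itv/= y0 lt_neqAle yn1.
have supS : has_ubound S by exists 1 => x /S01/andP[].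
have s01 : 0 <= sup S <= 1.
  have [->|/set0P[x Sx]] := eqVneq S set0; first by rewrite sup0 lexx ler01.
  have /andP[x0 _] := S01 x Sx; rewrite (le_trans x0) ?ub_le_sup//=.
  by apply: ge_sup; [exists x|move=> y /S01/andP[]].
have CS : {ae P, forall y, (T @` A) y <-> Omega_val y < sup S}.
  near=> y.
  have TNy : ~ (T @` N) y by near: y.
  have y1 : Omega_val y != 1 by near: y; exact: ae_Omega_neq.
  have ys : Omega_val y != sup S by near: y; exact: ae_Omega_neq.
  have [zA znA] := zC y TNy; split => [TAy|ys'].
    by rewrite lt_neqAle ys ub_le_sup//; exists y.
  apply: contrapT => TAy; move: ys'; apply/negP; rewrite -leNgt.
  (* The supremum of the empty set is 0, the right end point when T(A) is null. *)
  have [->|/set0P[x Sx]] := eqVneq S set0.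
    by rewrite sup0; have /andP[] := Omega_val01 y.
  apply: ge_sup; first by exists x.
  move=> _ [y' [TAy' TNy' y'1] <-]; rewrite leNgt; apply/negP => /ltW yy'.
  (* A point of T(A) to the right of [y] would give 1 <= 0 for [zeta]. *)
  have := zhomo _ _ (lt1 y y1) (lt1 y' y'1) yy'.
  by rewrite (znA TAy) (zC y' TNy').1// ler10.
have PS : P A = (sup S)%:E.
  have [mTA <-] := TP A (GF GA); rewrite -uniform01_lt//.
  by apply: eq_probability_ae => //; exact: measurable_Omega_lt.
by exists (T @` A); [exact: TG|rewrite PS].
Unshelve. all: by end_near. Qed.

Lemma level_le0 s : s <= 0 -> level s.
Proof.
move=> s0; exists set0; first exact: sub_algebra_set0.
apply: aeW => w; split => // ws; have /andP[w0 _] := Omega_val01 w.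
by move: ws; rewrite ltNge (le_trans s0 w0).
Qed.

Lemma level_ge1 s : 1 <= s -> level s.
Proof.
move=> s1; exists setT; first exact: sub_algebra_setT.
apply: filterS (ae_Omega_neq 1) => w w1; split => // _.
have /andP[_ w1'] := Omega_val01 w.
by rewrite (lt_le_trans _ s1)// lt_neqAle w1.
Qed.

(** A difference of sets of [G] has probability [t - s], and by [level_prob] every probability of a
    set of [G] is a level. *)
Lemma levelB s t : 0 <= s -> s <= t -> t <= 1 -> level s -> level t -> level (t - s).
Proof.
move=> s0 st t1 [C GC Cs] [D GD Dt].
have PDC : P (D `\` C) = (t - s)%:E.
  rewrite -uniform01_ico//; apply: eq_probability_ae.
  - by apply: GF; exact: sub_algebra_setD.
  - exact: measurable_Omega_ico.
  apply: filterS2 Cs Dt => w Cs Dt; split => [[/Dt wt nC]|/=/andP[sw wt]].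
    by rewrite /= wt andbT leNgt; apply/negP => /Cs.
  by split; [exact/Dt|move=> /Cs; rewrite ltNge sw].
by have := level_prob (sub_algebra_setD sG GD GC); rewrite PDC.
Qed.

Lemma levelD s t : 0 <= s -> 0 <= t -> s + t <= 1 -> level s -> level t ->
  level (s + t).
Proof.
(* The sum is written with differences only, each staying in [0, 1]. *)
move=> s0 t0 st ls lt; have -> : s + t = 1 - (1 - s - t) by ring.
apply: levelB; rewrite ?gerBl//; try lra; last exact: level_ge1.
apply: levelB => //; try lra.
by apply: levelB => //; [lra|exact: level_ge1].
Qed.

Lemma levelMn s k : 0 <= s -> level s -> s *+ k <= 1 -> level (s *+ k).
Proof.
move=> s0 ls; elim: k => [_|k IH]; first by rewrite mulr0n; exact: level_le0.
rewrite mulrS => sk1; apply: levelD => //; first exact: mulrn_wge0.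
by apply: IH; apply: le_trans sk1; rewrite lerDr.
Qed.

(** Multiples of ever smaller levels approach [c] from below, and a countable union of sets of [G]
    represents their supremum. *)
Lemma level_all : (forall e, 0 < e -> exists2 s, level s & 0 < s < e) ->
  forall c, level c.
Proof.
move=> small c; have [c0|c0] := leP c 0; first exact: level_le0.
have [c1|c1] := leP 1 c; first exact: level_ge1.
have /choice[e eP] : forall n : nat, exists e, level e /\ 0 < e < n.+1%:R^-1.
  by move=> n; have [|s ls s0] := small n.+1%:R^-1; [rewrite invr_gt0|exists s].
(* The largest multiple of [e n] that is at most [c]; it misses [c] by less than [e n]. *)
pose s n := e n *+ Num.truncn (c / e n).
have sP n : s n <= c < s n + n.+1%:R^-1.
  have [_ /andP[en0 en]] := eP n.
  have /truncn_itv/andP[lo hi] : 0 <= c / e n by rewrite divr_ge0 ?ltW.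
  rewrite /s -(mulr_natl (e n)) -ler_pdivlMr// lo/=.
  rewrite ltr_pdivrMr// -natr1 mulrDl mul1r in hi.
  by rewrite (lt_trans hi)// ltrD2l.
have /choice[C CP] : forall n, exists C, G C /\
    {ae P, forall w, C w <-> Omega_val w < s n}.
  move=> n; have [ln /andP[en0 _]] := eP n; have /andP[sc _] := sP n.
  have [|D GD' Ds] := levelMn (ltW en0) ln (k := Num.truncn (c / e n)).
    by rewrite (le_trans sc)// ltW.
  by exists D.
exists (\bigcup_n C n).
  by case: sG => _ _; apply => n; exact: (CP n).1.
have : {ae P, forall w, forall n, C n w <-> Omega_val w < s n}.
  by apply/ae_foralln => n; exact: (CP n).2.
apply: filterS => w Cw; split => [[n _ /Cw]|/ltr_add_invr[n wn]].
  by move=> /lt_le_trans; apply; have /andP[] := sP n.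
exists n => //; apply/Cw; have /andP[_ cs] := sP n.
by move: (lt_trans wn cs); rewrite ltrD2r.
Qed.

(* U w is the infimum of the rational thresholds r such that the set of G that
   represents [0, r) contains w. Adding 1 to the thresholds and keeping only the nonnegative ones forces the
   infimum to lie in [0, 1] at every point. *)
Lemma exists_ae_id : (forall c, level c) ->
  exists U : Omega R -> Omega R,
    (forall A, measurable A -> G (U @^-1` A)) /\ {ae P, forall w, U w = w}.
Proof.
move=> lev; have /choice[C CP] : forall r : rat, exists C, G C /\
    {ae P, forall w, C w <-> Omega_val w < ratr r}.
  by move=> r; have [C GC Cr] := lev (ratr r); exists C.
pose S w := [set x : R | x = 1 \/ exists r : rat, [/\ x = ratr r, 0 <= x & C r w]].
have S1 w : S w 1 by left.
have S0 w : lbound (S w) 0 by move=> x [->|[r []]].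
have lS w : has_lbound (S w) by exists 0.
have inf01 w : inf (S w) \in `[0, 1].
  by rewrite in_itv/= (ge_inf (lS w) (S1 w)) andbT; apply: lb_le_inf => //; exists 1.
pose U w : Omega R := exist _ (inf (S w)) (inf01 w).
exists U; split => [_ [B mB <-]|].
  have mu : measurable_fun (setT : set (g_sigma_algebraType G)) (fun w => inf (S w)).
    apply: (measurability _ (RGenInftyO.measurableE R)) => _ [_ [x ->] <-].
    rewrite setTI (_ : _ @^-1` _ = (if 1 < x then setT else set0) `|`
        \bigcup_r (if 0 <= ratr r :> R then
                     if ratr r < x then C r else set0 else set0)).
      apply: measurableU; first by case: ifP.
      apply: bigcupT_measurable_rat => r; rewrite sub_measurableE//.
      case: ifP => _; last exact: sub_algebra_set0.
      by case: ifP => _; [exact: (CP r).1|exact: sub_algebra_set0].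
    apply/seteqP; split => w; rewrite /= in_itv/=.
      move=> /(inf_lt (ex_intro _ _ (S1 w)))[_ [->|[r [-> r0 Cr]]] rx].
        by left; rewrite rx.
      by right; exists r => //; rewrite r0 rx.
    move=> [|[r _]].
      by case: ifP => // x1 _; exact: le_lt_trans (ge_inf (lS w) (S1 w)) x1.
    case: ifP => // r0; case: ifP => // rx Cr; apply: le_lt_trans rx.
    by apply: ge_inf => //; right; exists r.
  have := mu measurableT B mB; rewrite !setTI sub_measurableE//.
(* The rationals are enumerated by [unpickle], so that countably many a.e. statements hold at
   once. *)
have : {ae P, forall w, forall n : nat, if unpickle n is Some r then
    C r w <-> Omega_val w < ratr r else True}.
  apply/ae_foralln => n; case: (unpickle n) => [r|]; first exact: (CP r).2.
  exact: aeW.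
apply: filterS => w Cw; apply: Omega_val_inj; rewrite /Omega_val/itv01_val/=.
have /andP[w0 w1] := Omega_val01 w.
have {}Cw (r : rat) : C r w <-> Omega_val w < ratr r.
  by have := Cw (pickle r); rewrite pickleK.
apply/eqP; rewrite eq_le; apply/andP; split; last first.
  apply: lb_le_inf; first by exists 1.
  by move=> _ [->//|[r [-> _ /Cw/ltW]]].
rewrite leNgt; apply/negP => /rat_in_itvoo[r]; rewrite in_itv/= => /andP[wr].
rewrite ltNge => /negP; apply; apply: ge_inf => //; right; exists r; split => //.
  exact: ltW (le_lt_trans w0 wr).
exact/Cw.
Qed.

(** The gap makes the infimum of the positive levels a minimum [e]; division with remainder makes
    every level in [0, 1] a multiple of [e], and the level 1 gives [e = 1/n]. *)
Lemma level_lattice e0 : 0 < e0 -> (forall s, level s -> ~ 0 < s < e0) ->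
  exists n, [/\ (0 < n)%N, level n%:R^-1 & forall s, level s -> 0 <= s <= 1 ->
    exists k, s = k%:R / n%:R].
Proof.
move=> e00 gap; pose E := [set s | level s /\ 0 < s <= 1].
have E1 : E 1 by split; [exact: level_ge1|rewrite ltr01 lexx].
have hE : has_inf E by split; [exists 1|exists 0 => s [_ /andP[/ltW]]].
(* [e] lies within [e0] of the infimum, so a smaller positive level would differ from it by a level
   in the gap. *)
have [e [le /andP[e_gt0 e1]] einf] := inf_adherent e00 hE.
have emin s : level s -> 0 < s -> e <= s.
  move=> ls s0; rewrite leNgt; apply/negP => se.
  have s1 : s <= 1 by rewrite (le_trans (ltW se)).
  apply: (gap (e - s)); first by apply: levelB => //; exact: ltW.
  rewrite subr_gt0 se/= ltrBlDr (lt_le_trans einf)// [leRHS]addrC lerD2r.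
  by apply: (ge_inf hE.2); rewrite /E/= s0.
have mult s : level s -> 0 <= s <= 1 -> exists k, s = e *+ k.
  (* The remainder of the division by [e] is a level below [e], hence 0. *)
  move=> ls /andP[s0 s1]; exists (Num.truncn (s / e)).
  have /truncn_itv/andP[lo hi] : 0 <= s / e by rewrite divr_ge0// ltW.
  rewrite ler_pdivlMr// mulr_natl in lo.
  rewrite ltr_pdivrMr// -natr1 mulrDl mul1r mulr_natl -ltrBlDl in hi.
  have ek0 : 0 <= e *+ Num.truncn (s / e) by rewrite mulrn_wge0// ltW.
  have lk : level (e *+ Num.truncn (s / e)).
    by apply: levelMn => //; [exact: ltW|exact: le_trans lo s1].
  apply/eqP; rewrite eq_le lo andbT -subr_le0 leNgt; apply/negP => t0.
  by have := emin _ (levelB ek0 lo s1 lk ls) t0; rewrite leNgt hi.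
have [|n en] := mult 1 (level_ge1 (lexx 1)); first by rewrite ler01 lexx.
have n0 : (0 < n)%N by case: n en => // /eqP; rewrite mulr0n oner_eq0.
have eE : e = n%:R^-1.
  have nR0 : n%:R != 0 :> R by rewrite pnatr_eq0 -lt0n.
  by apply: (mulfI nR0); rewrite divff// mulr_natl.
exists n; split => //; first by rewrite -eE.
move=> s ls s01; have [k ->] := mult s ls s01; exists k.
by rewrite eE mulr_natl.
Qed.

(** The cell of a point is the first [i] for which the set of [G] representing [0, (i+1)/n) contains
    it. *)
Lemma exists_equipartition n : (0 < n)%N -> level n%:R^-1 ->
  exists I : Omega R -> 'I_n, forall i,
    G (I @^-1` [set i]) /\ P (I @^-1` [set i]) = (n%:R^-1)%:E.
Proof.
move=> n0 ln; have nR0 : 0 < n%:R :> R by rewrite ltr0n.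
have nV0 : 0 <= n%:R^-1 :> R by rewrite invr_ge0 ltW.
(* From [i = n - 1] on, [F i] is the whole space exactly and not just a.e., so every point has a
   cell. *)
have /choice[F FP] : forall i : nat, exists F, [/\ G F, (n <= i.+1)%N -> F = setT &
    {ae P, forall w, F w <-> Omega_val w < i.+1%:R / n%:R}].
  move=> i; have [ni|] := leqP n i.+1.
    have le1 : 1 <= (i.+1%:R / n%:R : R) by rewrite ler_pdivlMr// mul1r ler_nat.
    exists setT; split => //; first exact: sub_algebra_setT.
    apply: filterS (ae_Omega_neq 1) => w w1; split => // _.
    have /andP[_ w1'] := Omega_val01 w.
    by rewrite (lt_le_trans _ le1)// lt_neqAle w1.
  move=> ni; have [|C GC CP] := levelMn nV0 ln (k := i.+1).
    by rewrite -[_ *+ i.+1]mulr_natl ler_pdivrMr// mul1r ler_nat ltnW.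
  by exists C; split => //; rewrite mulr_natl.
have FT : F n.-1 = setT by have [_ -> //] := FP n.-1; rewrite prednK.
have /choice[I IP] : forall w, exists i : 'I_n,
    F i w /\ forall k, (k < i)%N -> ~ F k w.
  move=> w; have exF : exists k, `[< F k w >].
    by exists n.-1; apply/asboolP; rewrite FT.
  have [k /asboolP Fk kmin] := ex_minnP exF.
  have kn : (k < n)%N.
    rewrite -[ltnRHS](prednK n0) ltnS; apply: kmin; apply/asboolP.
    by rewrite FT.
  exists (Ordinal kn); split => // j /= jk Fj.
  by have := kmin j (asboolT Fj); rewrite leqNgt jk.
(* The [F k] are nested only up to null sets, so all earlier ones are removed. *)
have IE i : I @^-1` [set i] = F i `\` \bigcup_(k in [set k | (k < i)%N]) F k.
  apply/seteqP; split => w /= => [<-|[Fi nF]].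
    by split; [exact: (IP w).1|move=> [k /= ki]; exact: (IP w).2].
  have [FI nFI] := IP w; apply/ord_inj/eqP; rewrite eqn_leq.
  apply/andP; split; rewrite leqNgt; apply/negP => lt.
    exact: nFI lt Fi.
  by apply: nF; exists (I w).
exists I => i; have GI : G (I @^-1` [set i]).
  rewrite IE -(sub_measurableE sG); apply: measurableD.
    by rewrite sub_measurableE//; have [] := FP i.
  by apply: bigcup_measurable => k _; rewrite sub_measurableE//; have [] := FP k.
split => //.
have in01 : (i.+1%:R / n%:R : R) <= 1 by rewrite ler_pdivrMr// mul1r ler_nat.
have -> : n%:R^-1 = i.+1%:R / n%:R - i%:R / n%:R :> R.
  by rewrite -mulrBl -natr1 addrAC subrr add0r mul1r.
have ii1 : (i%:R / n%:R : R) <= i.+1%:R / n%:R.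
  by rewrite ler_pM2r ?invr_gt0// ler_nat.
rewrite -uniform01_ico ?divr_ge0//.
apply: eq_probability_ae; [exact: GF|exact: measurable_Omega_ico|].
have : {ae P, forall w, forall k, F k w <-> Omega_val w < k.+1%:R / n%:R}.
  by apply/ae_foralln => k; have [] := FP k.
apply: filterS => w Fw; rewrite IE; split => [[/Fw wi nF]|/= /andP[iw wi]].
  rewrite /= wi andbT; case: i {GI in01 ii1 wi} nF => -[|i] ilt nF /=.
    by rewrite mul0r; have /andP[] := Omega_val01 w.
  by rewrite leNgt; apply/negP => /Fw Fi; apply: nF; exists i => /=.
split; first exact/Fw.
move=> [k /= ki /Fw]; apply/negP; rewrite -leNgt; apply: le_trans iw.
by rewrite ler_pM2r ?invr_gt0// ler_nat.
Qed.

(** Cells are atoms: a set of [G] inside a cell has as probability a multiple of [1/n] that is at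
    most [1/n]. Applied to the sublevel sets of [Z], this gives the dichotomy of
    [ae_cst_of_dichotomy]. *)
Lemma atomic_ae_cst n p (I : Omega R -> 'I_n) : (0 < n)%N ->
  (forall s, level s -> 0 <= s <= 1 -> exists k, s = k%:R / n%:R) ->
  (forall i, G (I @^-1` [set i]) /\ P (I @^-1` [set i]) = (n%:R^-1)%:E) ->
  forall Z, sub_Lp_space P G p Z ->
    exists v : 'I_n -> R, {ae P, forall w, Z w = v (I w)}.
Proof.
move=> n0 lat IP Z [_ GZ]; have nR0 : 0 < n%:R^-1 :> R by rewrite invr_gt0 ltr0n.
suff /choice[v vP] : forall i, exists z,
    {ae P, forall w, (I @^-1` [set i]) w -> Z w = z}.
  have H : {ae P, forall w, forall i, (I @^-1` [set i]) w -> Z w = v i}.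
    by apply: filter_forall; exact: vP.
  by exists v; apply: filterS H => w; exact.
move=> i; have [GIi PIi] := IP i.
apply: ae_cst_of_dichotomy => [c|]; last first.
  move=> /(ae_notP (uniform01 R : probability _ R) (GF GIi)) PB.
  have : (n%:R^-1)%:E = 0%E :> \bar R by rewrite -PIi; exact: PB.
  by move=> -[/eqP]; rewrite gt_eqF.
pose A := I @^-1` [set i] `&` Z @^-1` `]-oo, c].
have GA : G A by apply: sub_algebra_setI => //; exact: GZ.
have PA : (P A <= (n%:R^-1)%:E)%E.
  by rewrite -PIi; apply: le_measure; rewrite ?inE; [exact: GF|exact: GF|move=> w []].
have PAfin : P A \is a fin_num by rewrite fin_num_measure//; exact: GF.
have PA01 : 0 <= fine (P A) <= 1.
  by rewrite fine_ge0//= -lee_fin fineK//; exact: probability_le1 (GF GA).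
have [k kE] := lat _ (level_prob GA) PA01.
have : k%:R / n%:R <= n%:R^-1 :> R by rewrite -kE -lee_fin fineK.
rewrite ler_pdivrMr ?ltr0n// mulVf ?pnatr_eq0 -?lt0n// lern1.
(* For [k = 0] the sublevel set is null in the cell; for [k = 1] it fills the cell up to a null
   set. *)
case: k kE => [|[|//]] kE _.
  right; have PA0 : P A = 0%E by rewrite -(fineK PAfin) kE mul0r.
  apply: filterS ((ae_notP (uniform01 R : probability _ R) (GF GA)).2 PA0) => w nA Iw.
  by rewrite ltNge; apply/negP => Zc; apply: nA; split.
left; have GB := sub_algebra_setD sG GIi (GZ _ (measurable_itv `]-oo, c])).
have PB0 : P (I @^-1` [set i] `\` Z @^-1` `]-oo, c]) = 0%E.
  have PIy : (P (I @^-1` [set i]) < +oo)%E by rewrite PIi ltry.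
  transitivity (P (I @^-1` [set i]) - P A)%E.
    exact: (measureD (GF GIi) (GF (GZ _ (measurable_itv `]-oo, c]))) PIy).
  by rewrite PIi -(fineK PAfin) kE mul1r subee.
apply: filterS ((ae_notP (uniform01 R : probability _ R) (GF GB)).2 PB0) => w nB Iw.
by rewrite leNgt; apply/negP => Zc; apply: nB; split=> //=; rewrite in_itv/= leNgt Zc.
Qed.

Lemma sub_Lp_equipartition n p (I : Omega R -> 'I_n) (v : 'I_n -> R) :
  (1 <= p)%E -> (forall i, G (I @^-1` [set i])) -> sub_Lp_space P G p (v \o I).
Proof.
move=> p1 GI'; split=> [|B mB].
  apply: (@Lfun_bounded _ _ _ _ _ _ (\sum_i `|v i|)) => //.
    by apply: measurable_equipartition => i; exact: GF.
  by move=> w; rewrite /= (bigD1 (I w))//= lerDl sumr_ge0.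
rewrite -(sub_measurableE sG) -[X in measurable X]setTI.
have mI i : measurable (I @^-1` [set i] : set (g_sigma_algebraType G)).
  by rewrite sub_measurableE.
exact: (measurable_equipartition mI v measurableT mB).
Qed.

End Levels.

(** Needed to place indicators in L_q by [Lfun_bounded]. For finite nonzero [q], 1/q = 1 - 1/p lies
    in [0, 1]. *)
Lemma conjugate_exponent_ge1 (R : realType) (p : R) (q : \bar R) :
  1 <= p -> ((p%:E)^-1 + q^-1 = 1)%E -> (1 <= q)%E.
Proof.
move=> p1; have p0 : 0 < p by apply: lt_le_trans p1.
rewrite inver gt_eqF//; case: q => [q||]; last by rewrite inveNy.
  (* The inverse of 0 is [+oo], so [q = 0] contradicts the equation. *)
  rewrite inver; case: eqP => [->|/eqP q0]; first by rewrite addey.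
  rewrite -EFinD => -[pq]; rewrite lee_fin.
  have qE : q^-1 = 1 - p^-1 by rewrite -pq addrAC subrr add0r.
  have qge0 : 0 <= q^-1 by rewrite qE subr_ge0 invf_le1.
  rewrite -(invrK q) invf_ge1 ?lt_neqAle ?qge0 ?andbT ?invr_eq0 1?eq_sym//.
    by rewrite qE gerBl invr_ge0 ltW.
  by rewrite invr_eq0.
by rewrite leey.
Qed.

Theorem theorem3p1 (R : realType) (p : R) (q : \bar R)
  (p1 : 1 <= p) (pq : ((p%:E)^-1 + q^-1 = 1)%E)
  (G : set (set (Omega R)))
  (sG : sigma_algebra [set: Omega R] G) (GF : G `<=` measurable)
  (hG : forall eta : Omega R -> R,
    sub_Lp_space (uniform01 R) G q eta ->
    {ae uniform01 R, forall w, 0 <= eta w} ->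
    exists (zeta : R -> R) (T : Omega R -> Omega R),
      [/\ {in `[0, 1[ &, {homo zeta : s t / s <= t}},
          {in `[0, 1[, forall t, zeta x @[x --> t^'+] --> zeta t},
          preserving_transformations (uniform01 R) G T &
          {ae uniform01 R, forall w, eta w = zeta (Omega_val (T w))}])
  (vrho : (Omega R -> R) -> R) :
  coherent_risk_measure (uniform01 R) (sub_Lp_space (uniform01 R) G p%:E) vrho ->
  law_invariant (uniform01 R) (sub_Lp_space (uniform01 R) G p%:E) vrho ->
  regular_risk_measure (uniform01 R) G p%:E vrho.
Proof.
move=> crm li; have q1 : (1 <= q)%E := conjugate_exponent_ge1 p1 pq.
(* Either there are arbitrarily small positive levels, the dense case, or there is a gap above 0,
   the discrete one. *)
have [small|/existsNP[e0 /not_implyP[e00 gap]]] :=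
    pselect (forall e, 0 < e -> exists2 s, level G s & 0 < s < e).
  have [U [GU Uid]] := exists_ae_id sG (level_all q1 sG GF hG small).
  exact: (regular_of_ae_id p1 GF GU Uid crm li).
have {}gap s : level G s -> ~ 0 < s < e0 by move=> ls s0; apply: gap; exists s.
have [n [n0 ln lat]] := level_lattice q1 sG GF hG e00 gap.
have [I IP] := exists_equipartition q1 sG GF hG n0 ln.
apply: (@regular_of_equipartition _ _ _ _ n n0 I) => //.
- by move=> i; exact/GF/(IP i).1.
- by move=> i; exact: (IP i).2.
- by move=> v; apply: sub_Lp_equipartition => // i; exact: (IP i).1.
- by move=> Z XZ; exact: (atomic_ae_cst q1 sG GF hG n0 lat IP XZ).
Qed.
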